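(* Let $\phi$ be a formula. If $\vdash_{\mathsf{C}} \phi$, then $\Vdash \phi$ over the basis $\mathfrak{B}=\mathfrak{C}$. Likewise, if $\vdash_{\mathsf{I}} \phi$, then $\Vdash \phi$ over the basis $\mathfrak{B}=\mathfrak{I}$.
   Context: Syntax. Fix denumerable sets of variables $\mathcal{V}$, constants $\mathcal{K}$, function symbols of each arity $n$, and predicate symbols of each arity $n$. Terms, atomic formulae (atoms) $P(t_1,\dots,t_n)$, and first-order formulae over $\bot,\land,\lor,\to,\forall,\exists$ are defined as usual; $\bot$ is NOT an atom, and $\neg\phi$ abbreviates $\phi\to\bot$. $\mathrm{FV}(\phi)$ is the set of free variables of $\phi$; an expression is closed if it has no free variables. $\mathrm{cl}(\mathcal{T})$ and $\mathrm{cl}(\mathcal{A})$ are the sets of closed terms and closed atoms. $\phi[x\mapsto t]$ is the (capture-avoiding) substitution of $t$ for the free occurrences of $x$ in $\phi$. For $\mathrm{FV}(\phi)=\{x_1,\dots,x_n\}$, the universal closure of $\phi$ is $\forall x_1\cdots\forall x_n\,\phi$. Proof systems. For $\mathsf{A}\in\{\mathsf{C},\mathsf{I}\}$ the relation $\Gamma\vdash_{\mathsf{A}}\phi$ ($\Gamma$ a set of formulae) is defined inductively by: (Axiom) $\Gamma\vdash_{\mathsf{A}}\alpha$ if $\alpha$ is an instance of a scheme in $\mathsf{A}$; (Hypothesis) $\Gamma\vdash_{\mathsf{A}}\phi$ if $\phi\in\Gamma$; (Modus Ponens) if $\Gamma\vdash_{\mathsf{A}}\phi$ and $\Gamma\vdash_{\mathsf{A}}\phi\to\psi$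 then $\Gamma\vdash_{\mathsf{A}}\psi$; (Generalization) if $\Gamma\vdash_{\mathsf{A}}\psi\to\phi$ and $x\notin\mathrm{FV}(\psi)$ then $\Gamma\vdash_{\mathsf{A}}\psi\to\forall x\phi$; (Existential Instantiation) if $\Gamma\vdash_{\mathsf{A}}\phi\to\psi$ and $x\notin\mathrm{FV}(\psi)$ then $\Gamma\vdash_{\mathsf{A}}\exists x\phi\to\psi$. We write $\vdash_{\mathsf{A}}\phi$ for $\emptyset\vdash_{\mathsf{A}}\phi$. The instances of the schemes of $\mathsf{I}$ are, for all formulae $X,Y,Z$, variables $x$ and terms $t$: $X\to(Y\to X)$; $(X\to(Y\to Z))\to((X\to Y)\to(X\to Z))$; $\forall xX\to X[x\mapsto t]$; $X\to(Y\to(X\land Y))$; $X\land Y\to X$; $X\land Y\to Y$; $X\to X\lor Y$; $Y\to X\lor Y$; $(X\to Z)\to((Y\to Z)\to(X\lor Y\to Z))$; $X[x\mapsto t]\to\exists xX$; $(X\to Y)\to((X\to\neg Y)\to\neg X)$; $(X\to\bot)\to(X\to Y)$. The schemes of $\mathsf{C}$ are those of $\mathsf{I}$ together with $\neg\neg X\to X$. Atomic systems. An atomic rule is a pair $\{\mathbb{P}_1\Rightarrow P_1,\dots,\mathbb{P}_n\Rightarrow P_n\}\Rightarrow P$ with $n\geq 0$, $\mathbb{P}_1,\dots,\mathbb{P}_n\subseteq\mathrm{cl}(\mathcal{A})$ and $P_1,\dots,P_n,P\in\mathrm{cl}(\mathcal{A})$. It is zero-level if $n=0$, first-level if $n\neq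 0$ and all $\mathbb{P}_i=\emptyset$, and second-level otherwise. An atomic system is a set of atomic rules. Derivability $\mathbb{P}\vdash_{\mathscr{S}}P$ in an atomic system $\mathscr{S}$ (with $\mathbb{P}\subseteq\mathrm{cl}(\mathcal{A})$, $P\in\mathrm{cl}(\mathcal{A})$) is defined inductively: if $P\in\mathbb{P}$ then $\mathbb{P}\vdash_{\mathscr{S}}P$; if $\{\mathbb{P}_1\Rightarrow P_1,\dots,\mathbb{P}_n\Rightarrow P_n\}\Rightarrow P\in\mathscr{S}$ and $\mathbb{P}\cup\mathbb{P}_i\vdash_{\mathscr{S}}P_i$ for all $i=1,\dots,n$, then $\mathbb{P}\vdash_{\mathscr{S}}P$. Bases. A basis $\mathfrak{B}$ is a set of atomic systems; its elements are called bases. For a basis $\mathfrak{B}$, $\mathscr{C}\supseteq_{\mathfrak{B}}\mathscr{B}$ means $\mathscr{B},\mathscr{C}\in\mathfrak{B}$ and $\mathscr{C}\supseteq\mathscr{B}$. $\mathfrak{C}$ is the set of atomic systems all of whose rules are zero- or first-level; $\mathfrak{I}$ is the set of atomic systems all of whose rules are zero-, first- or second-level. Support. Relative to a basis $\mathfrak{B}$, for $\mathscr{B}\in\mathfrak{B}$ and closed formulae: $\Vdash_{\mathscr{B}}P$ iff $\emptyset\vdash_{\mathscr{B}}P$, for $P\in\mathrm{cl}(\mathcal{A})$; $\Vdash_{\mathscr{B}}\phi\to\psi$ iff $\{\phi\}\Vdash_{\mathscr{B}}\psi$; $\Vdash_{\mathscr{B}}\phi\land\psi$ iff $\Vdash_{\mathscr{B}}\phi$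 and $\Vdash_{\mathscr{B}}\psi$; $\Vdash_{\mathscr{B}}\forall x\phi$ iff $\Vdash_{\mathscr{B}}\phi[x\mapsto t]$ for every $t\in\mathrm{cl}(\mathcal{T})$; $\Vdash_{\mathscr{B}}\bot$ iff $\Vdash_{\mathscr{B}}P$ for every $P\in\mathrm{cl}(\mathcal{A})$; $\Vdash_{\mathscr{B}}\phi\lor\psi$ iff for every $\mathscr{C}\supseteq_{\mathfrak{B}}\mathscr{B}$ and $P\in\mathrm{cl}(\mathcal{A})$, if $\{\phi\}\Vdash_{\mathscr{C}}P$ and $\{\psi\}\Vdash_{\mathscr{C}}P$ then $\Vdash_{\mathscr{C}}P$; $\Vdash_{\mathscr{B}}\exists x\phi$ iff for every $\mathscr{C}\supseteq_{\mathfrak{B}}\mathscr{B}$ and $P\in\mathrm{cl}(\mathcal{A})$, if $\{\phi[x\mapsto t]\}\Vdash_{\mathscr{C}}P$ for every $t\in\mathrm{cl}(\mathcal{T})$ then $\Vdash_{\mathscr{C}}P$; for non-empty $\Delta$: $\Delta\Vdash_{\mathscr{B}}\phi$ iff for every $\mathscr{C}\supseteq_{\mathfrak{B}}\mathscr{B}$, if $\Vdash_{\mathscr{C}}\psi$ for all $\psi\in\Delta$ then $\Vdash_{\mathscr{C}}\phi$ (and $\emptyset\Vdash_{\mathscr{B}}\phi$ means $\Vdash_{\mathscr{B}}\phi$). For open formulae, $\Vdash_{\mathscr{B}}\phi$ is defined to mean that $\mathscr{B}$ supports the universal closure of $\phi$. Finally, $\Vdash\phi$ over the basis $\mathfrak{B}$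 means $\Vdash_{\mathscr{B}}\phi$ for every $\mathscr{B}\in\mathfrak{B}$. *)

(* Defs.v *)
From mathcomp Require Import all_boot finmap boolp classical_sets cardinality.

Set Implicit Arguments.
Unset Strict Implicit.
Unset Printing Implicit Defensive.

Local Open Scope fset_scope.
Local Open Scope classical_set_scope.

Definition denumerable (T : Type) : Prop := exists f : T -> nat, bijective f.

(* Arity 0 is allowed for function and predicate symbols. *)
Record language := Language {
  var : choiceType;
  cst : Type;
  fsym : nat -> Type;
  psym : nat -> Type;
  var_denum : denumerable var;
  cst_denum : denumerable cst;
  fsym_denum : forall n, denumerable (fsym n);
  psym_denum : forall n, denumerable (psym n) }.

Section Syntax.
Variable L : language.

Inductive term :=
| Var of var L
| Cst of cst L
| App n of fsym L n & {ffun 'I_n -> term}.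

Inductive atom := Atom n of psym L n & {ffun 'I_n -> term}.

Inductive form :=
| Atm of atom
| Bot
| And of form & form
| Or of form & form
| Imp of form & form
| All of var L & form
| Ex of var L & form.

Definition Neg (phi : form) := Imp phi Bot.

Fixpoint fv_term (t : term) : {fset var L} :=
  match t with
  | Var x => [fset x]%fset
  | Cst _ => fset0
  | App n _ ts => (\bigcup_(i <- enum 'I_n) fv_term (ts i))%fset
  end.

Definition fv_atom (a : atom) : {fset var L} :=
  let: Atom n _ ts := a in (\bigcup_(i <- enum 'I_n) fv_term (ts i))%fset.

Fixpoint fv (phi : form) : {fset var L} :=
  match phi with
  | Atm a => fv_atom a
  | Bot => fset0
  | And phi psi | Or phi psi | Imp phi psi => (fv phi `|` fv psi)%fset
  | All x phi | Ex x phi => (fv phi `\ x)%fset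
  end.

Definition cl_term : set term := [set t | fv_term t = fset0].
Definition cl_atom : set atom := [set a | fv_atom a = fset0].

Lemma ex_fresh (A : {fset var L}) : exists x, x \notin A.
Proof.
have [f [g fK gK]] := var_denum L.
pose s := map g (iota 0 (size A).+1).
have us : uniq s by rewrite map_inj_uniq ?iota_uniq //; exact: can_inj gK.
have [/allP sA|/allPn[x _ xA]] := boolP (all (mem A) s); last by exists x.
by have := uniq_leq_size us sA; rewrite size_map size_iota ltnn.
Qed.

Definition fresh (A : {fset var L}) : var L := xchoose (ex_fresh A).

(* Capture-avoiding substitution is defined simultaneously for all variables,
   which makes it structurally recursive: under a binder x of body phi, x is
   kept unless it occurs in the image of a free variable of the quantified
   formula, in which case it is renamed to a fresh variable. *)
Definition update (s : var L -> term) (x : var L) (t : term) : var L -> term :=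
  fun y => if y == x then t else s y.

Definition binder (s : var L -> term) (phi : form) (x : var L) : var L :=
  let A := (\bigcup_(y <- fv phi `\ x) fv_term (s y))%fset in
  if x \in A then fresh A else x.

Fixpoint msubst_term (s : var L -> term) (t : term) : term :=
  match t with
  | Var x => s x
  | Cst c => Cst c
  | App n f ts => App f [ffun i => msubst_term s (ts i)]
  end.

Definition msubst_atom (s : var L -> term) (a : atom) : atom :=
  let: Atom n p ts := a in Atom p [ffun i => msubst_term s (ts i)].

Fixpoint msubst (s : var L -> term) (phi : form) : form :=
  match phi with
  | Atm a => Atm (msubst_atom s a)
  | Bot => Bot
  | And phi psi => And (msubst s phi) (msubst s psi)
  | Or phi psi => Or (msubst s phi) (msubst s psi)
  | Imp phi psi => Imp (msubst s phi) (msubst s psi)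
  | All x phi =>
      let z := binder s phi x in All z (msubst (update s x (Var z)) phi)
  | Ex x phi =>
      let z := binder s phi x in Ex z (msubst (update s x (Var z)) phi)
  end.

Definition subst (x : var L) (t : term) (phi : form) : form :=
  msubst (update Var x t) phi.

(* The variables are quantified in the (arbitrary) order in which the finite
   set fv phi enumerates them. *)
Definition uclosure (phi : form) : form := foldr All phi (fv phi).

Inductive axiomI : form -> Prop :=
| AxK X Y : axiomI (Imp X (Imp Y X))
| AxS X Y Z :
    axiomI (Imp (Imp X (Imp Y Z)) (Imp (Imp X Y) (Imp X Z)))
| AxAll x t X : axiomI (Imp (All x X) (subst x t X))
| AxPair X Y : axiomI (Imp X (Imp Y (And X Y)))
| AxFst X Y : axiomI (Imp (And X Y) X)
| AxSnd X Y : axiomI (Imp (And X Y) Y)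
| AxInl X Y : axiomI (Imp X (Or X Y))
| AxInr X Y : axiomI (Imp Y (Or X Y))
| AxCase X Y Z : axiomI (Imp (Imp X Z) (Imp (Imp Y Z) (Imp (Or X Y) Z)))
| AxEx x t X : axiomI (Imp (subst x t X) (Ex x X))
| AxNeg X Y : axiomI (Imp (Imp X Y) (Imp (Imp X (Neg Y)) (Neg X)))
| AxExfalso X Y : axiomI (Imp (Imp X Bot) (Imp X Y)).

Inductive axiomC : form -> Prop :=
| AxI X : axiomI X -> axiomC X
| AxDNE X : axiomC (Imp (Neg (Neg X)) X).

Inductive proves (A Gamma : set form) : form -> Prop :=
| ProvAx phi : A phi -> proves A Gamma phi
| ProvHyp phi : Gamma phi -> proves A Gamma phi
| ProvMP phi psi :
    proves A Gamma phi -> proves A Gamma (Imp phi psi) -> proves A Gamma psi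
| ProvGen x phi psi :
    x \notin fv psi -> proves A Gamma (Imp psi phi) ->
    proves A Gamma (Imp psi (All x phi))
| ProvExInst x phi psi :
    x \notin fv psi -> proves A Gamma (Imp phi psi) ->
    proves A Gamma (Imp (Ex x phi) psi).

(* The premiss PP_i => P_i is the pair (PP_i, P_i). *)
Record rule := Rule {
  prem : set (set atom * atom);
  concl : atom;
  prem_finite : finite_set prem;
  prem_closed : forall p, prem p -> p.1 `<=` cl_atom /\ cl_atom p.2;
  concl_closed : cl_atom concl }.

Definition zero_level (r : rule) : Prop := prem r = set0.
Definition first_level (r : rule) : Prop :=
  prem r <> set0 /\ forall p, prem r p -> p.1 = set0.
Definition second_level (r : rule) : Prop := ~ zero_level r /\ ~ first_level r.

Definition asystem := set rule.

Inductive derives (S : asystem) : set atom -> atom -> Prop :=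
| DerRef PP P : PP P -> derives S PP P
| DerApp PP r : S r ->
    (forall p, prem r p -> derives S (PP `|` p.1) p.2) ->
    derives S PP (concl r).

Definition basis := set asystem.

Definition extends (BB : basis) (C B : asystem) : Prop :=
  [/\ BB B, BB C & B `<=` C].

Definition basisC : basis :=
  [set S | forall r, S r -> zero_level r \/ first_level r].
Definition basisI : basis :=
  [set S | forall r, S r -> [\/ zero_level r, first_level r | second_level r]].

(* Consequence relative to a support relation S, for nonempty Delta only: the
   empty Delta would have to be read as S B phi. *)
Definition entails (BB : basis) (S : asystem -> form -> Prop)
    (Delta : set form) (B : asystem) (phi : form) : Prop :=
  forall C, extends BB C B -> (forall psi, Delta psi -> S C psi) -> S C phi.

Fixpoint rank (phi : form) : nat :=
  match phi with
  | Atm _ => 0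
  | Bot => 1
  | And phi psi | Or phi psi | Imp phi psi => (maxn (rank phi) (rank psi)).+1
  | All _ phi | Ex _ phi => (rank phi).+1
  end.

(* The clauses for the quantifiers refer to substitution instances, so support
   is defined by recursion on a bound n on the rank; the lemmas supp_atm, ...,
   supp_ex below are the defining clauses, free of the bound. The relation is
   only meant for closed formulae. *)
Fixpoint supp_rec (BB : basis) (n : nat) (B : asystem) (phi : form) : Prop :=
  if n isn't n'.+1 then False else
  let S := supp_rec BB n' in
  match phi with
  | Atm a => derives B set0 a
  | Imp phi psi => entails BB S [set phi] B psi
  | And phi psi => S B phi /\ S B psi
  | All x phi => forall t, cl_term t -> S B (subst x t phi)
  | Bot => forall P, cl_atom P -> S B (Atm P)
  | Or phi psi =>
      forall C P, extends BB C B -> cl_atom P ->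
        entails BB S [set phi] C (Atm P) ->
        entails BB S [set psi] C (Atm P) -> S C (Atm P)
  | Ex x phi =>
      forall C P, extends BB C B -> cl_atom P ->
        (forall t, cl_term t ->
           entails BB S [set subst x t phi] C (Atm P)) -> S C (Atm P)
  end.

Definition supp (BB : basis) (B : asystem) (phi : form) : Prop :=
  supp_rec BB (rank phi).+1 B phi.

Definition valid (BB : basis) (phi : form) : Prop :=
  forall B, BB B -> supp BB B (uclosure phi).

Lemma rank_subst x t phi : rank (subst x t phi) = rank phi.
Proof.
rewrite /subst; elim: phi (update _ _ _) => //=.
- by move=> f IHf g IHg s; rewrite IHf IHg.
- by move=> f IHf g IHg s; rewrite IHf IHg.
- by move=> f IHf g IHg s; rewrite IHf IHg.
- by move=> y f IHf s; rewrite IHf.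
- by move=> y f IHf s; rewrite IHf.
Qed.

Lemma supp_recE BB n B phi : rank phi < n -> supp_rec BB n B phi = supp BB B phi.
Proof.
suff H m : rank phi < n -> rank phi < m ->
    supp_rec BB n B phi = supp_rec BB m B phi by move=> h; exact: H.
elim: n m B phi => [//|n IH] [//|m] B phi.
have E1 C psi X : rank psi < n -> rank psi < m -> rank X < n -> rank X < m ->
    entails BB (supp_rec BB n) [set psi] C X =
    entails BB (supp_rec BB m) [set psi] C X.
  move=> pn pm Xn Xm; apply/propext; split=> H D CD Hpsi.
    rewrite -(IH m) //; apply: H => // _ ->.
    by rewrite (IH m) //; exact: Hpsi.
  by rewrite (IH m) //; apply: H => // _ ->; rewrite -(IH m) //; exact: Hpsi.
case: phi => [a||f g|f g|f g|x f|x f] //=; rewrite ?ltnS ?gtn_max.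
- by move=> n0 m0; apply/propext; split=> H P cP; have := H P cP; rewrite (IH m).
- by move=> /andP[? ?] /andP[? ?]; rewrite !(IH m).
- move=> /andP[fn gn] /andP[fm gm].
  have n0 : 0 < n by apply: leq_trans fn.
  have m0 : 0 < m by apply: leq_trans fm.
  apply/propext; split=> H C P BC cP.
    by rewrite -!E1 // -(IH m) //; exact: H.
  by rewrite !E1 // (IH m) //; exact: H.
- by move=> /andP[? ?] /andP[? ?]; rewrite E1.
- move=> fn fm; apply/propext; split=> H t ct; have := H t ct;
    by rewrite (IH m) ?rank_subst.
- move=> fn fm.
  have n0 : 0 < n by apply: leq_trans fn.
  have m0 : 0 < m by apply: leq_trans fm.
  apply/propext; split=> H C P BC cP Ht.
    by rewrite -(IH m) //; apply: H => // t ct; rewrite E1 ?rank_subst //; exact: Ht.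
  by rewrite (IH m) //; apply: H => // t ct; rewrite -E1 ?rank_subst //; exact: Ht.
Qed.

Lemma entails_recE BB n Delta B phi :
  (forall psi, Delta psi -> rank psi < n) -> rank phi < n ->
  entails BB (supp_rec BB n) Delta B phi = entails BB (supp BB) Delta B phi.
Proof.
move=> Dn pn; apply/propext; split=> H C BC HD.
  rewrite -(supp_recE _ _ pn); apply: H => // psi Dpsi.
  by rewrite supp_recE; [exact: HD|exact: Dn].
rewrite supp_recE //; apply: H => // psi Dpsi.
by rewrite -(supp_recE _ _ (Dn _ Dpsi)); exact: HD.
Qed.

Section SupportClauses.
Variables (BB : basis) (B : asystem).

Lemma supp_atm P : supp BB B (Atm P) <-> derives B set0 P.
Proof. by []. Qed.

Lemma supp_imp phi psi :
  supp BB B (Imp phi psi) <-> entails BB (supp BB) [set phi] B psi.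
Proof.
rewrite -[supp _ _ _]/(entails BB (supp_rec BB (maxn (rank phi) (rank psi)).+1) [set phi] B psi) entails_recE //.
  by move=> _ ->; rewrite ltnS leq_maxl.
by rewrite ltnS leq_maxr.
Qed.

Lemma supp_and phi psi :
  supp BB B (And phi psi) <-> supp BB B phi /\ supp BB B psi.
Proof.
rewrite -[supp _ _ (And _ _)]/((supp_rec BB (maxn (rank phi) (rank psi)).+1) B phi /\ (supp_rec BB (maxn (rank phi) (rank psi)).+1) B psi) !supp_recE //.
  by rewrite ltnS leq_maxr.
by rewrite ltnS leq_maxl.
Qed.

Lemma supp_all x phi :
  supp BB B (All x phi) <->
  forall t, cl_term t -> supp BB B (subst x t phi).
Proof.
rewrite -[supp _ _ _]/(forall t, cl_term t -> (supp_rec BB (rank phi).+1) B (subst x t phi)).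
by split=> H t ct; have := H t ct; rewrite supp_recE // rank_subst.
Qed.

Lemma supp_bot :
  supp BB B Bot <-> forall P, cl_atom P -> supp BB B (Atm P).
Proof. by []. Qed.

Lemma supp_or phi psi :
  supp BB B (Or phi psi) <->
  forall C P, extends BB C B -> cl_atom P ->
    entails BB (supp BB) [set phi] C (Atm P) ->
    entails BB (supp BB) [set psi] C (Atm P) -> supp BB C (Atm P).
Proof.
rewrite -[supp _ _ (Or _ _)]/(forall C P, extends BB C B -> cl_atom P ->
  entails BB (supp_rec BB (maxn (rank phi) (rank psi)).+1) [set phi] C (Atm P) ->
  entails BB (supp_rec BB (maxn (rank phi) (rank psi)).+1) [set psi] C (Atm P) -> (supp_rec BB (maxn (rank phi) (rank psi)).+1) C (Atm P)).
by split=> H C P BC cP; have := H C P BC cP; rewrite !entails_recE //;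
  move=> _ ->; rewrite ltnS ?leq_maxl ?leq_maxr.
Qed.

Lemma supp_ex x phi :
  supp BB B (Ex x phi) <->
  forall C P, extends BB C B -> cl_atom P ->
    (forall t, cl_term t ->
       entails BB (supp BB) [set subst x t phi] C (Atm P)) ->
    supp BB C (Atm P).
Proof.
rewrite -[supp _ _ (Ex _ _)]/(forall C P, extends BB C B -> cl_atom P ->
  (forall t, cl_term t -> entails BB (supp_rec BB (rank phi).+1) [set subst x t phi] C (Atm P)) ->
  (supp_rec BB (rank phi).+1) C (Atm P)).
split=> H C P BC cP Ht; apply: H => // t ct; have := Ht t ct;
  by rewrite entails_recE // => _ ->; rewrite rank_subst.
Qed.

End SupportClauses.

Lemma uclosure_closed phi : fv phi = fset0 -> uclosure phi = phi.
Proof. by rewrite /uclosure => ->. Qed.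

End Syntax.

Arguments axiomI {L}.
Arguments axiomC {L}.
Arguments basisC {L}.
Arguments basisI {L}.

(* Main.v *)
Require Import Defs.
From mathcomp Require Import all_boot finmap boolp classical_sets cardinality.

(** Soundness is an induction on derivations, but the clauses for the
quantifiers in the definition of support pass to capture-avoiding substitution
instances, where bound variables may be renamed.  The proof therefore works
with the relation [esupp phi e B], which evaluates an arbitrary formula [phi]
in an environment [e] assigning closed terms to the variables, by structural
recursion on [phi].  For it, substituting in the formula is the same as
composing environments ([esupp_msubst]), since renaming a bound variable does
not change the environments under which the body is evaluated.  On closed
formulae, [esupp] is support ([supp_esupp]), so it is enough to prove that
every theorem is [esupp]-supported at every base in every closed environment.

The clauses for disjunction, existence and absurdity quantify over atomic
conclusions only.  All three have the form [locally Q]: an atom holds as soon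
as it holds at every extension at which [Q] does.  Here [Q] is respectively
support of one of the disjuncts, support of some instance, and falsehood.  The
central fact is that every formula, and not only every atom, is local
([esupp_local]): if [phi] is supported wherever [Q] holds and [Q] holds locally
at [B], then [phi] is supported at [B].  This gives elimination of
disjunctions, existentials and absurdity into arbitrary formulae, hence
soundness of intuitionistic logic over every basis ([sound]).

For classical logic it remains to see that a doubly negated formula holds
locally, and this reduces to atoms ([atom_stable]).  If [B] supports the double
negation of an atom [P], add to [B] the rules deriving every closed atom from
[P].  The extended base supports the negation of [P], hence is inconsistent,
hence derives [P].  If this derivation applies an added rule, then above a
topmost such application stands a derivation of [P] in [B] alone, and it
depends on no hypothesis because the rules of [basisC] discharge none. *)

Set Implicit Arguments.
Unset Strict Implicit.
Unset Printing Implicit Defensive.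

Local Open Scope fset_scope.
Local Open Scope classical_set_scope.

(** * Substitution in terms and atoms *)

Section Substitution.
Variable L : language.
Implicit Types (s e : var L -> term L) (x y z : var L) (t : term L).
Implicit Types (a : atom L) (phi : form L).

Definition closed_env e : Prop := forall x, cl_term (e x).

(** The induction principle generated for [term] gives no hypothesis on the
arguments of a function symbol, which are nested in a finite function. *)
Lemma term_args_ind (P : term L -> Prop) :
  (forall x, P (Var x)) -> (forall c, P (Cst c)) ->
  (forall n (f : Defs.fsym L n) (ts : {ffun 'I_n -> term L}),
     (forall i, P (ts i)) -> P (App f ts)) ->
  forall t, P t.
Proof.
move=> PV PC PA; fix IH 1 => -[x|c|n f ts]; first exact: PV; first exact: PC.
by apply: PA => i; exact: IH.
Qed.

Lemma fv_args n (ts : {ffun 'I_n -> term L}) x :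
  reflect (exists i, x \in fv_term (ts i))
    (x \in (\bigcup_(i <- enum 'I_n) fv_term (ts i))%fset).
Proof.
apply: (iffP (bigfcupP _ _ _ _)) => [[i _ xi]|[i xi]]; first by exists i.
by exists i; rewrite // mem_enum.
Qed.

Lemma msubst_term_comp e s t :
  msubst_term e (msubst_term s t) = msubst_term (msubst_term e \o s) t.
Proof.
elim/term_args_ind: t => //= n f ts IH; congr App.
by apply/ffunP => i; rewrite !ffunE.
Qed.

Lemma msubst_atom_comp e s a :
  msubst_atom e (msubst_atom s a) = msubst_atom (msubst_term e \o s) a.
Proof.
case: a => n p ts /=; congr Atom.
by apply/ffunP => i; rewrite !ffunE msubst_term_comp.
Qed.

Lemma eq_msubst_term s s' t :
  {in fv_term t, s =1 s'} -> msubst_term s t = msubst_term s' t.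
Proof.
elim/term_args_ind: t => [x|c|n f ts IH] //= ss'; first by rewrite ss' // inE.
congr App; apply/ffunP => i; rewrite !ffunE; apply: IH => x xi.
by apply: ss'; apply/fv_args; exists i.
Qed.

Lemma eq_msubst_atom s s' a :
  {in fv_atom a, s =1 s'} -> msubst_atom s a = msubst_atom s' a.
Proof.
case: a => n p ts /= ss'; congr Atom; apply/ffunP => i; rewrite !ffunE.
by apply: eq_msubst_term => x xi; apply: ss'; apply/fv_args; exists i.
Qed.

Lemma msubst_term_Var t : msubst_term (@Var L) t = t.
Proof.
elim/term_args_ind: t => //= n f ts IH; congr App.
by apply/ffunP => i; rewrite ffunE.
Qed.

Lemma msubst_cl_term e t : cl_term t -> msubst_term e t = t.
Proof.
rewrite /cl_term /= => t0; rewrite -[RHS]msubst_term_Var.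
by apply: eq_msubst_term => x; rewrite t0 inE.
Qed.

Lemma msubst_cl_atom e a : cl_atom a -> msubst_atom e a = a.
Proof.
case: a => n p ts /= a0; congr Atom; apply/ffunP => i; rewrite ffunE.
apply: msubst_cl_term; apply/eqP; rewrite -fsubset0 -a0.
by apply/fsubsetP => x xi; apply/fv_args; exists i.
Qed.

Lemma fv_msubst_term s t z : z \in fv_term (msubst_term s t) ->
  exists2 y, y \in fv_term t & z \in fv_term (s y).
Proof.
elim/term_args_ind: t => [x|c|n f ts IH] //= zs.
  by exists x; rewrite ?inE.
have /fv_args[i] := zs; rewrite ffunE => /IH[y yi zy].
by exists y => //; apply/fv_args; exists i.
Qed.

Lemma fv_msubst_atom s a z : z \in fv_atom (msubst_atom s a) ->
  exists2 y, y \in fv_atom a & z \in fv_term (s y).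
Proof.
case: a => n p ts /= /fv_args[i]; rewrite ffunE => /fv_msubst_term[y yi zy].
by exists y => //; apply/fv_args; exists i.
Qed.

Lemma cl_msubst_term e t : closed_env e -> cl_term (msubst_term e t).
Proof.
move=> ce; apply/eqP; rewrite -fsubset0; apply/fsubsetP => z.
by move=> /fv_msubst_term[y _]; rewrite (ce y).
Qed.

Lemma cl_msubst_atom e a : closed_env e -> cl_atom (msubst_atom e a).
Proof.
move=> ce; apply/eqP; rewrite -fsubset0; apply/fsubsetP => z.
by move=> /fv_msubst_atom[y _]; rewrite (ce y).
Qed.

Lemma closed_env_update e x t :
  closed_env e -> cl_term t -> closed_env (update e x t).
Proof. by move=> ce ct y; rewrite /update; case: ifP. Qed.

Lemma exists_closed_env : exists e, closed_env e.
Proof. by have [f [g _ _]] := cst_denum L; exists (fun=> Cst (g 0)). Qed.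

(** * Substitution in formulae *)

Lemma binder_fresh s phi x y :
  y \in (fv phi `\ x)%fset -> binder s phi x \notin fv_term (s y).
Proof.
move=> yphi; rewrite /binder; set A := (\bigcup_(_ <- _) _)%fset.
have sA z : z \notin A -> z \notin fv_term (s y).
  by apply: contra => zy; apply/bigfcupP; exists y; rewrite ?yphi.
case: ifP => [_|/negbT]; last exact: sA.
by apply: sA; exact: xchooseP (ex_fresh A).
Qed.

Lemma fv_msubst s phi z : z \in fv (msubst s phi) ->
  exists2 y, y \in fv phi & z \in fv_term (s y).
Proof.
have under_binder x psi s' : (forall s'' z, z \in fv (msubst s'' psi) ->
      exists2 y, y \in fv psi & z \in fv_term (s'' y)) ->
    forall b z, z \in (fv (msubst (update s' x (Var b)) psi) `\ b)%fset ->
    exists2 y, y \in (fv psi `\ x)%fset & z \in fv_term (s' y).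
  move=> IH b w; rewrite in_fsetD1 => /andP[wb /IH[y ypsi]].
  rewrite /update; case: eqP => [_|/eqP yx wy].
    by rewrite /= inE (negbTE wb).
  by exists y; rewrite // in_fsetD1 yx.
elim: phi s z => [a||f IHf g IHg|f IHf g IHg|f IHf g IHg|x f IH|x f IH] s z /=.
- exact: fv_msubst_atom.
- by rewrite inE.
- by rewrite inE => /orP[/IHf|/IHg] [y yf zy]; exists y; rewrite // inE yf ?orbT.
- by rewrite inE => /orP[/IHf|/IHg] [y yf zy]; exists y; rewrite // inE yf ?orbT.
- by rewrite inE => /orP[/IHf|/IHg] [y yf zy]; exists y; rewrite // inE yf ?orbT.
- exact: under_binder.
- exact: under_binder.
Qed.

Lemma fv_subst_closed x t phi :
  (fv phi `\ x)%fset = fset0 -> cl_term t -> fv (subst x t phi) = fset0.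
Proof.
move=> phi0 ct; apply/eqP; rewrite -fsubset0; apply/fsubsetP => z.
move=> /fv_msubst[y yphi]; rewrite /update; case: eqP => [_|/eqP yx].
  by rewrite ct.
by have := in_fset0 y; rewrite -phi0 in_fsetD1 yx yphi.
Qed.

Lemma fv_foldr_All (xs : seq (var L)) phi z :
  (z \in fv (foldr (@All L) phi xs)) = (z \in fv phi) && (z \notin xs).
Proof.
elim: xs => [|x xs IH] /=; first by rewrite andbT.
by rewrite in_fsetD1 IH in_cons negb_or andbCA.
Qed.

Lemma fv_uclosure phi : fv (uclosure phi) = fset0.
Proof. by apply/fsetP => z; rewrite fv_foldr_All andbN inE. Qed.

End Substitution.

(** * Support of open formulae in closed environments *)

Section EnvironmentSupport.
Variables (L : language) (BB : basis L).
Implicit Types (B C D : asystem L) (Q R : set (asystem L)).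
Implicit Types (e s : var L -> term L) (x y z : var L) (t : term L).
Implicit Types (phi psi : form L).

Lemma extends_refl B : BB B -> extends BB B B.
Proof. by move=> bB; split. Qed.

Lemma extends_trans C B D : extends BB C B -> extends BB D C -> extends BB D B.
Proof. by case=> bB _ BC [_ bD CD]; split=> //; exact: subset_trans CD. Qed.

Lemma derives_mono B C PP P : B `<=` C -> derives B PP P -> derives C PP P.
Proof.
move=> BC; elim=> {PP P} [PP P PPP|PP r Br _ IH]; first exact: DerRef.
by apply: DerApp => //; exact: BC.
Qed.

(** The closure operator behind the clauses for [Or], [Ex] and [Bot]: from the
standpoint of atomic conclusions drawn at extensions of [B], [Q] may be
assumed. *)
Definition locally Q : set (asystem L) := fun B =>
  forall C P, extends BB C B -> cl_atom P ->
    (forall D, extends BB D C -> Q D -> derives D set0 P) -> derives C set0 P.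

Lemma locally_mono Q B C : extends BB C B -> locally Q B -> locally Q C.
Proof. by move=> BC QB D P CD; apply: QB; exact: extends_trans CD. Qed.

Lemma locally_imp Q R B :
  (forall C, extends BB C B -> Q C -> R C) -> locally Q B -> locally R B.
Proof.
move=> QR QB C P BC cP RP; apply: QB => // D CD QD.
by apply: RP => //; apply: QR => //; exact: extends_trans CD.
Qed.

Lemma locally_unit Q B :
  (forall C, extends BB C B -> Q B -> Q C) -> Q B -> locally Q B.
Proof.
move=> Qmono QB C P BC cP QP; apply: QP (Qmono C BC QB).
by apply: extends_refl; case: BC.
Qed.

Lemma locally_idem Q B : locally (locally Q) B -> locally Q B.
Proof.
move=> QB C P BC cP QP; apply: (QB C P) => // D CD lD.
have Drefl : extends BB D D by apply: extends_refl; case: CD.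
by apply: (lD D P) => // E DE QE; apply: QP => //; exact: extends_trans DE.
Qed.

Fixpoint esupp phi e : set (asystem L) :=
  match phi with
  | Atm a => fun B => derives B set0 (msubst_atom e a)
  | Bot => locally set0
  | And phi psi => fun B => esupp phi e B /\ esupp psi e B
  | Or phi psi => locally (fun C => esupp phi e C \/ esupp psi e C)
  | Imp phi psi => fun B =>
      forall C, extends BB C B -> esupp phi e C -> esupp psi e C
  | All x phi => fun B => forall t, cl_term t -> esupp phi (update e x t) B
  | Ex x phi =>
      locally (fun C => exists2 t, cl_term t & esupp phi (update e x t) C)
  end.

Lemma esupp_mono phi e B C :
  extends BB C B -> esupp phi e B -> esupp phi e C.
Proof.
elim: phi e => [a||f IHf g IHg|f IHf g IHg|f IHf g IHg|x f IH|x f IH] e BC /=.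
- by apply: derives_mono; case: BC.
- exact: locally_mono.
- by move=> [Bf Bg]; split; [exact: IHf|exact: IHg].
- exact: locally_mono.
- by move=> Bfg D CD; apply: Bfg; exact: extends_trans CD.
- by move=> Bf t ct; apply: IH => //; exact: Bf.
- exact: locally_mono.
Qed.

(** The clauses of [esupp] that are not themselves of the form [locally Q]
are conjunctions and function spaces, which inherit locality from their
components; for atoms it is the definition of [locally]. *)
Lemma esupp_local phi e B :
  closed_env e -> BB B -> locally (esupp phi e) B -> esupp phi e B.
Proof.
elim: phi e B => [a||f IHf g IHg|f IHf g IHg|f IHf g IHg|x f IH|x f IH] e B
  ce bB /=; try exact: locally_idem.
- move=> aB; apply: (aB B _ (extends_refl bB)) => //.
  exact: cl_msubst_atom.
- move=> fgB; split; [apply: IHf => //|apply: IHg => //];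
    by apply: locally_imp fgB => C _ [].
- move=> fgB C BC fC; have [_ bC _] := BC; apply: IHg => //.
  apply: locally_imp (locally_mono BC fgB) => D CD fgD.
  apply: fgD (esupp_mono CD fC).
  by apply: extends_refl; case: CD.
- move=> fB t ct; apply: IH => //; first exact: closed_env_update.
  by apply: locally_imp fB => C _; apply.
Qed.

Lemma esupp_elim Q phi e B : closed_env e -> BB B -> locally Q B ->
  (forall C, extends BB C B -> Q C -> esupp phi e C) -> esupp phi e B.
Proof.
by move=> ce bB QB Qphi; apply: esupp_local => //; exact: locally_imp QB.
Qed.

Lemma eq_locally Q R : (forall B, Q B <-> R B) -> locally Q = locally R.
Proof. by move=> QR; congr locally; apply/funext => B; exact/propext. Qed.

Lemma eq_esupp phi e e' : {in fv phi, e =1 e'} -> esupp phi e = esupp phi e'.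
Proof.
have under_binder x psi e1 e2 t : {in (fv psi `\ x)%fset, e1 =1 e2} ->
    {in fv psi, update e1 x t =1 update e2 x t}.
  move=> ee y ypsi; rewrite /update; case: eqP => // /eqP yx.
  by apply: ee; rewrite in_fsetD1 yx.
have splitU f g e1 e2 : {in (fv f `|` fv g)%fset, e1 =1 e2} ->
    {in fv f, e1 =1 e2} /\ {in fv g, e1 =1 e2}.
  by move=> ee; split=> y yf; apply: ee; rewrite inE yf ?orbT.
elim: phi e e' => [a||f IHf g IHg|f IHf g IHg|f IHf g IHg|x f IH|x f IH]
  e e' //= ee.
- by rewrite (eq_msubst_atom ee).
- by have [ef eg] := splitU _ _ _ _ ee; rewrite (IHf e e') ?(IHg e e').
- by have [ef eg] := splitU _ _ _ _ ee; rewrite (IHf e e') ?(IHg e e').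
- by have [ef eg] := splitU _ _ _ _ ee; rewrite (IHf e e') ?(IHg e e').
- apply/funext => B; apply: eq_forall => t.
  by rewrite (IH _ (update e' x t)) //; exact: under_binder.
- apply: eq_locally => B; split=> -[t ct Bt]; exists t => //; move: Bt;
    by rewrite (IH _ (update e' x t)) //; exact: under_binder.
Qed.

Lemma eq_esupp_update psi e x t :
  x \notin fv psi -> esupp psi (update e x t) = esupp psi e.
Proof.
move=> xpsi; apply: eq_esupp => y ypsi; rewrite /update.
by case: eqP ypsi => // -> xin; rewrite xin in xpsi.
Qed.

(** Under a binder renamed to [z], a value [t] is assigned to [z] before the
substitution is evaluated; since [z] is not free in the image of any other
free variable of the body, the effect is to assign [t] to the original bound
variable. *)
Lemma esupp_msubst phi e s :
  esupp (msubst s phi) e = esupp phi (msubst_term e \o s).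
Proof.
have under_binder x f e1 s1 t :
    {in fv f, msubst_term (update e1 (binder s1 f x) t) \o
                update s1 x (Var (binder s1 f x)) =1
              update (msubst_term e1 \o s1) x t}.
  move=> y yf; rewrite /update /=; case: eqP => [_|/eqP yx] /=.
    by rewrite eqxx.
  apply: eq_msubst_term => w wy; case: eqP => // wz.
  have /negP[] : binder s1 f x \notin fv_term (s1 y).
    by apply: binder_fresh; rewrite in_fsetD1 yx.
  by rewrite -wz.
elim: phi e s => [a||f IHf g IHg|f IHf g IHg|f IHf g IHg|x f IH|x f IH] e s //=.
- by rewrite msubst_atom_comp.
- by rewrite IHf IHg.
- by rewrite IHf IHg.
- by rewrite IHf IHg.
- apply/funext => B; apply: eq_forall => t.
  by rewrite IH (eq_esupp (under_binder _ _ _ _ _)).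
- apply: eq_locally => B; split=> -[t ct Bt]; exists t => //; move: Bt;
    by rewrite IH (eq_esupp (under_binder _ _ _ _ _)).
Qed.

Lemma esupp_subst phi e x t :
  esupp (subst x t phi) e = esupp phi (update e x (msubst_term e t)).
Proof.
rewrite /subst esupp_msubst; congr esupp; apply/funext => y /=.
by rewrite /update; case: eqP.
Qed.

(** The recursion is on the rank because the quantifier clauses of [supp] are
stated for substitution instances; these are closed again, so that the
environment is irrelevant. *)
Lemma supp_esupp phi e B : closed_env e -> fv phi = fset0 -> BB B ->
  supp BB B phi <-> esupp phi e B.
Proof.
move=> ce; have [n] := ubnP (rank phi).
elim: n phi B => [//|n IH] phi B.
have IHE psi C P : rank psi < n -> fv psi = fset0 -> BB C ->
    entails BB (supp BB) [set psi] C (Atm P) <->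
    (forall D, extends BB D C -> esupp psi e D -> derives D set0 P).
  move=> rn psi0 bC; split=> H D CD.
    by have [_ bD _] := CD; move=> /IH psiD; apply: H => // _ ->; exact: psiD.
  by have [_ bD _] := CD; move=> psiD; apply: H => //; apply/IH => //; exact: psiD.
have fvU (X Y : {fset var L}) :
    (X `|` Y)%fset = fset0 -> X = fset0 /\ Y = fset0.
  by move=> /eqP; rewrite fsetU_eq0 => /andP[/eqP ? /eqP].
case: phi => [a||f g|f g|f g|x f|x f];
  rewrite [fv _]/= [rank _]/= ?ltnS ?gtn_max.
- by move=> _ a0 bB; rewrite supp_atm /= msubst_cl_atom.
- move=> _ _ bB; rewrite supp_bot; split=> [BP C P [_ _ BC] cP _|BP P cP].
    exact: derives_mono BC (BP P cP).
  by apply/supp_atm; apply: BP (extends_refl bB) cP _.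
- move=> /andP[fn gn] /fvU[f0 g0] bB.
  by rewrite supp_and (IH f) // (IH g).
- move=> /andP[fn gn] /fvU[f0 g0] bB; rewrite supp_or /=.
  split=> H C P BC cP; have [_ bC _] := BC; have := H C P BC cP;
    rewrite !IHE // => {}H.
    by move=> fgP; apply: H => D CD hD; apply: fgP => //; [left|right].
  by move=> fP gP; apply: H => D CD [/fP|/gP]; exact.
- move=> /andP[fn gn] /fvU[f0 g0] bB; rewrite supp_imp /=.
  split=> H C BC; have [_ bC _] := BC.
    by move=> /(IH f) fC; apply/IH => //; apply: H => // _ ->; exact: fC.
  by move=> fC; apply/IH => //; apply: H => //; apply/IH => //; exact: fC.
- move=> fn f0 bB; rewrite supp_all /=.
  have sE t : cl_term t ->
      supp BB B (subst x t f) <-> esupp f (update e x t) B.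
    move=> ct; rewrite IH ?rank_subst ?fv_subst_closed //.
    by rewrite esupp_subst msubst_cl_term.
  by split=> H t ct; apply/sE => //; exact: H.
- move=> fn f0 bB; rewrite supp_ex /=.
  have sE C P t : BB C -> cl_term t ->
      entails BB (supp BB) [set subst x t f] C (Atm P) <->
      (forall D, extends BB D C -> esupp f (update e x t) D ->
         derives D set0 P).
    move=> bC ct; rewrite IHE ?rank_subst ?fv_subst_closed //.
    by rewrite esupp_subst msubst_cl_term.
  split=> H C P BC cP HP; have [_ bC _] := BC; apply: (H C P BC cP).
    by move=> t ct; apply/sE => // D CD fD; apply: HP => //; exists t.
  by move=> D CD [t ct]; exact: (sE C P t bC ct).1 (HP t ct) D CD.
Qed.

(** * Soundness *)

Definition evalid phi : Prop :=
  forall e B, closed_env e -> BB B -> esupp phi e B.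

Lemma evalid_valid phi : evalid phi -> valid BB phi.
Proof.
move=> vphi B bB; have [e ce] := exists_closed_env L.
apply/(supp_esupp ce) => //; first exact: fv_uclosure.
rewrite /uclosure; elim: (fv phi : seq _) e ce => [|x xs IH] e ce /=.
  exact: vphi.
by move=> t ct; apply: IH; exact: closed_env_update.
Qed.

Lemma evalid_imp phi psi :
  (forall e B, closed_env e -> BB B -> esupp phi e B -> esupp psi e B) ->
  evalid (Imp phi psi).
Proof. by move=> H e B ce bB C [_ bC _]; exact: H. Qed.

Lemma axiomI_evalid phi : axiomI phi -> evalid phi.
Proof.
case=> {phi} [X Y|X Y Z|x t X|X Y|X Y|X Y|X Y|X Y|X Y Z|x t X|X Y|X Y];
  apply: evalid_imp => e C ce bC.
- by move=> XC D CD _; exact: esupp_mono XC.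
- move=> XYZ D CD XY E DE XE; have [_ bE _] := DE.
  by apply: (XYZ E (extends_trans CD DE) XE E); [exact: extends_refl|exact: XY].
- by rewrite esupp_subst => XC; apply: XC; exact: cl_msubst_term.
- by move=> XC D CD YD; split=> //; exact: esupp_mono XC.
- by case.
- by case.
- by move=> XC; apply: locally_unit => [D CD|]; [case=> h; [left|right];
    exact: esupp_mono h|left].
- by move=> YC; apply: locally_unit => [D CD|]; [case=> h; [left|right];
    exact: esupp_mono h|right].
- move=> XZ D CD YZ E DE XYE; have [_ bE _] := DE.
  apply: esupp_elim XYE _ => // F EF [XF|YF].
    by apply: XZ => //; exact: extends_trans (extends_trans CD DE) EF.
  by apply: YZ => //; exact: extends_trans DE EF.
- rewrite esupp_subst => XC; apply: locally_unit.
    by move=> D CD [u cu Xu]; exists u => //; exact: esupp_mono Xu.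
  by exists (msubst_term e t) => //; exact: cl_msubst_term.
- move=> XY D CD XnY E DE XE; have [_ bE _] := DE.
  apply: (XnY E DE XE E (extends_refl bE)).
  by apply: XY => //; exact: extends_trans CD DE.
- move=> nX D CD XD; have [_ bD _] := CD.
  by apply: (esupp_elim ce bD (nX D CD XD)).
Qed.

Lemma sound (A : set (form L)) : (forall phi, A phi -> evalid phi) ->
  forall phi, proves A set0 phi -> evalid phi.
Proof.
move=> Avalid phi; elim=> {phi} [phi /Avalid //|//|phi psi _ IH1 _ IH2||].
- by move=> e B ce bB; apply: (IH2 e B) (IH1 e B _ _) => //; exact: extends_refl.
- move=> x phi psi xpsi _ IH; apply: evalid_imp => e B ce bB psiB t ct.
  have psiBt : esupp psi (update e x t) B by rewrite eq_esupp_update.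
  apply: (IH (update e x t) B) (extends_refl bB) psiBt => //.
  exact: closed_env_update.
- move=> x phi psi xpsi _ IH; apply: evalid_imp => e B ce bB phiB.
  apply: (esupp_elim ce bB phiB) => C [_ bC _] [t ct phiC].
  rewrite -(eq_esupp_update e t xpsi).
  apply: (IH (update e x t) C) (extends_refl bC) phiC => //.
  exact: closed_env_update.
Qed.

End EnvironmentSupport.

(** * Double negation elimination over first-level bases *)

Section Classical.
Variable L : language.
Implicit Types (B C D : asystem L) (e : var L -> term L) (P R : atom L).

Let absurd_prem P : set (set (atom L) * atom L) := [set (set0, P)].

Lemma absurd_prem_closed P (cP : cl_atom P) p :
  absurd_prem P p -> p.1 `<=` @cl_atom L /\ cl_atom p.2.
Proof. by move=> ->; split. Qed.

Definition absurd_rule P R (cP : cl_atom P) (cR : cl_atom R) : rule L :=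
  Rule (finite_set1 (set0, P)) (@absurd_prem_closed P cP) cR.

Definition refute B P : asystem L :=
  B `|` [set r | exists cP R (cR : cl_atom R), r = @absurd_rule P R cP cR].

Lemma refute_basisC B P : basisC B -> basisC (refute B P).
Proof.
move=> bB r [/bB //|[cP [R [cR ->]]]]; right; split=> /=.
  by move=> /seteqP[/(_ (set0, P)) h _]; exact: h.
by move=> p ->.
Qed.

Lemma refute_absurd B D P R : refute B P `<=` D -> cl_atom P -> cl_atom R ->
  derives D set0 P -> derives D set0 R.
Proof.
move=> sD cP cR PD; apply: (@DerApp _ D set0 (absurd_rule cP cR)).
  by apply: sD; right; exists cP, R, cR.
by move=> p /= ->; rewrite setU0.
Qed.

(** Every added rule has [P] as premiss, so a topmost application of one has
above it a derivation of [P] in [B]; the context stays empty along the way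
because first-level rules discharge nothing. *)
Lemma derives_refute B P R : basisC B ->
  derives (refute B P) set0 R -> derives B set0 R \/ derives B set0 P.
Proof.
move=> bB RC; have [PB|nPB] := pselect (derives B set0 P); first by right.
left; move: RC; move: {-1}set0 (erefl (@set0 (atom L))) => PP PP0 RC.
elim: RC PP0 => {PP R} [PP R PPR|PP r rC _ IH] PP0; first by rewrite -PP0 in PPR.
rewrite -{PP}PP0 in IH *.
case: rC => [Br|[cP [R [cR rE]]]].
  have prem0 p : prem r p -> p.1 = set0.
    by case: (bB r Br) => [-> //|[_]]; exact.
  by apply: DerApp => // p rp; apply: IH; rewrite // prem0 // setU0.
by case: nPB; have := IH (set0, P); rewrite rE /= setU0; exact.
Qed.

(** The hypothesis is support of the double negation of [P], with the two
negations unfolded. *)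
Lemma atom_stable B P : basisC B -> cl_atom P ->
  (forall C, extends basisC C B ->
     (forall D, extends basisC D C -> derives D set0 P -> locally basisC set0 D) ->
     locally basisC set0 C) ->
  derives B set0 P.
Proof.
move=> bB cP nnP; pose C := refute B P; have bC : basisC C := refute_basisC bB.
have botC : locally basisC set0 C.
  apply: nnP; first by split=> //; exact: subsetUl.
  move=> D [_ _ CD] PD E R [_ _ DE] cR _.
  apply: refute_absurd cP cR _; first exact: subset_trans CD DE.
  exact: derives_mono PD.
have PC : derives C set0 P by apply: botC (extends_refl bC) cP _.
by case: (derives_refute bB PC).
Qed.

(** An atomic conclusion [P] that holds wherever [X] does is refuted only
where [X] is, so the double negation of [X] yields that of [P]. *)
Lemma dne_evalid (X : form L) : evalid basisC (Imp (Neg (Neg X)) X).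
Proof.
apply: evalid_imp => e C ce bC nnX.
apply: esupp_local => // D P CD cP XP; have [_ bD _] := CD.
apply: atom_stable => // E DE nP.
apply: (nnX E (extends_trans CD DE)) => F EF XF.
by apply: nP => //; apply: XP => //; exact: extends_trans EF.
Qed.

End Classical.

Theorem theorem24 (L : language) (phi : form L) :
  (proves axiomC set0 phi -> valid basisC phi) /\
  (proves axiomI set0 phi -> valid basisI phi).
Proof.
split=> phi_thm; apply: evalid_valid; move: phi_thm; apply: sound => X.
  by case=> {X} [X /axiomI_evalid|X]; [exact|exact: dne_evalid].
exact: axiomI_evalid.
Qed.
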